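(* Let $X$ and $Y$ be real, separable, reflexive Banach spaces with duals $X'$ and $Y'$, and let $A: X\to Y'$ be a (possibly nonlinear) operator which is weakly continuous and linearly mapped coercive. Then for every $b\in Y'$ there exists $x\in X$ with $A(x)=b$.
   Context: $\langle\cdot,\cdot\rangle$ denotes the duality pairing between $Y'$ and $Y$; $L(X,Y)$ is the space of bounded linear operators from $X$ to $Y$. Weakly continuous means: whenever $x_n\rightharpoonup x$ weakly in $X$ (sequences), then $A(x_n)\stackrel{*}{\rightharpoonup}A(x)$ weakly-$*$ in $Y'$. Linearly mapped coercive means: there exists a surjective $\Phi\in L(X,Y)$ such that $$\liminf_{x\in X,\ \|x\|_X\to\infty}\frac{\langle A(x),\Phi x\rangle}{\|x\|_X}=+\infty,$$ i.e. for every $K>0$ there is $R>0$ such that $\langle A(x),\Phi x\rangle\ge K\|x\|_X$ for all $x\in X$ with $\|x\|_X\ge R$. *)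

(* Defs.v *)
From HB Require Import structures.
From mathcomp Require Import all_boot all_order all_algebra.
From mathcomp Require Import all_classical all_reals all_analysis.

Set Implicit Arguments.
Unset Strict Implicit.
Unset Printing Implicit Defensive.

Import Order.TTheory GRing.Theory Num.Theory.
Import numFieldNormedType.Exports.

Local Open Scope classical_set_scope.
Local Open Scope ring_scope.

Section BoundedLinear.
Context {R : realType} (V W : normedModType R).

Definition bounded_linear : {pred V -> W} :=
  [pred f | `[< bounded_fun_norm f /\ linear f >]].

Lemma bounded_linear_submod : submod_closed bounded_linear.
Proof.
split=> [|a f g].
  apply/asboolP; split=> [r|a x y].
    by exists 0 => x _; rewrite normr0.
  by rewrite [RHS](_ : _ = a *: 0 + 0) ?scaler0 ?addr0.
rewrite !inE => -[bf lf] [bg lg]; split=> [r|b x y].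
  have [M Mf] := bf r; have [N Ng] := bg r.
  exists (`|a| * M + N) => x xr.
  rewrite (le_trans (ler_normD _ _))// lerD ?Ng//.
  by rewrite normrZ ler_wpM2l// Mf.
have fgE u : (a *: f + g) u = a *: f u + g u by [].
by rewrite !fgE lf lg !scalerDr !scalerA (mulrC a b) addrACA.
Qed.

HB.instance Definition _ :=
  GRing.isSubmodClosed.Build R (V -> W) bounded_linear bounded_linear_submod.

(* The space L(V, W), as a subspace of the space of all functions V -> W. *)
Record blin := Blin { blin_fun :> V -> W; blinP : blin_fun \in bounded_linear }.

HB.instance Definition _ := [isSub for blin_fun].
HB.instance Definition _ := [Choice of blin by <:].
HB.instance Definition _ := [SubChoice_isSubLmodule of blin by <:].

Lemma blin_linear (f : blin) : linear f.
Proof. by have := blinP f; rewrite inE => -[]. Qed.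

HB.instance Definition _ (f : blin) :=
  GRing.isLinear.Build R V W *:%R f (blin_linear f).

Lemma blin_bounded (f : blin) : bounded_fun_norm f.
Proof. by have := blinP f; rewrite inE => -[]. Qed.

Definition opnorm (f : blin) : R := sup [set `|f x| | x in [set x | `|x| <= 1]].

Lemma opnorm_has_sup (f : blin) :
  has_sup [set `|f x| | x in [set x | `|x| <= 1]].
Proof.
split; first by exists `|f 0|, 0; rewrite //= normr0 ler01.
by have [M fM] := blin_bounded f 1; exists M => _ [x /= x1 <-]; exact: fM.
Qed.

Lemma opnorm_ub (f : blin) x : `|x| <= 1 -> `|f x| <= opnorm f.
Proof.
by move=> x1; apply: sup_upper_bound; [exact: opnorm_has_sup | exists x].
Qed.

Lemma opnorm_le (f : blin) c :
  (forall x, `|x| <= 1 -> `|f x| <= c) -> opnorm f <= c.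
Proof.
move=> fc; apply: ge_sup; first by case: (opnorm_has_sup f).
by move=> _ [x /= x1 <-]; exact: fc.
Qed.

Lemma le_opnorm (f : blin) x : `|f x| <= opnorm f * `|x|.
Proof.
have [->|x0] := eqVneq x 0; first by rewrite linear0 !normr0 mulr0.
have nx0 : 0 < `|x| by rewrite normr_gt0.
rewrite -ler_pdivrMr// mulrC -[`|x|^-1]gtr0_norm ?invr_gt0// -normrZ -linearZ.
by apply: opnorm_ub; rewrite normrZ gtr0_norm ?invr_gt0// mulVf ?gt_eqF.
Qed.

Lemma opnormD (f g : blin) : opnorm (f + g) <= opnorm f + opnorm g.
Proof.
apply: opnorm_le => x x1.
by rewrite (le_trans (ler_normD _ _))// lerD ?opnorm_ub.
Qed.

Let opnormZ_le (a : R) (f : blin) : opnorm (a *: f) <= `|a| * opnorm f.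
Proof.
by apply: opnorm_le => x x1; rewrite [leLHS]normrZ ler_wpM2l// opnorm_ub.
Qed.

Lemma opnormZ (a : R) (f : blin) : opnorm (a *: f) = `|a| * opnorm f.
Proof.
apply/eqP; rewrite eq_le opnormZ_le/=.
have [->|a0] := eqVneq a 0.
  rewrite normr0 mul0r (le_trans (normr_ge0 ((0 *: f) 0)))//.
  by apply: opnorm_ub; rewrite normr0.
rewrite -ler_pdivlMl ?normr_gt0// -normfV (le_trans _ (opnormZ_le _ _))//.
by rewrite scalerA mulVf// scale1r.
Qed.

Lemma opnorm0_eq0 (f : blin) : opnorm f = 0 -> f = 0.
Proof.
move=> f0; apply/val_inj/funext => x; apply/normr0_eq0/eqP.
have := le_opnorm f x; rewrite f0 mul0r => fx0.
by rewrite eq_le normr_ge0 andbT.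
Qed.

HB.instance Definition _ :=
  Lmodule_isNormed.Build R blin opnormD opnormZ opnorm0_eq0.

End BoundedLinear.
Arguments bounded_linear {R} V W.

Section Dual.
Context {R : realType} (V : normedModType R).

Definition dual := blin V R^o.

HB.instance Definition _ := NormedModule.copy dual (blin V R^o).

End Dual.

Identity Coercion dual_to_blin : dual >-> blin.

Section Bidual.
Context {R : realType} (V : normedModType R).

Lemma eval_bounded_linear (x : V) :
  (fun f : dual V => f x : R^o) \in bounded_linear (dual V) R^o.
Proof.
rewrite inE; split=> [r|//].
exists (r * `|x|) => f fr.
by rewrite (le_trans (le_opnorm f x))// ler_wpM2r.
Qed.

Definition bidual_embedding (x : V) : dual (dual V) :=
  Blin (eval_bounded_linear x).

Definition reflexive_space := forall phi : dual (dual V),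
  exists x : V, bidual_embedding x = phi.

End Bidual.

Definition separable_space (T : topologicalType) :=
  exists D : set T, countable D /\ dense D.

Section Operators.
Context {R : realType}.

Definition weak_cvg (X : normedModType R) (u : nat -> X) (x : X) :=
  forall f : dual X, f (u n) @[n --> \oo] --> f x.

Definition weakstar_cvg (Y : normedModType R) (g : nat -> dual Y)
    (l : dual Y) :=
  forall y : Y, g n y @[n --> \oo] --> l y.

Definition weakly_continuous (X Y : normedModType R) (A : X -> dual Y) :=
  forall (u : nat -> X) (x : X), weak_cvg u x -> weakstar_cvg (A \o u) (A x).

(* The filter of the limit |x| -> +oo in X; it is improper when X = 0, in which
   case every liminf along it is +oo. *)
Definition norm_pinfty (X : normedModType R) : set_system X :=
  [set P | \forall r \near +oo, forall x, r <= `|x| -> P x].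

Definition linearly_mapped_coercive (X Y : normedModType R) (A : X -> dual Y) :=
  exists Phi : blin X Y,
    (forall y : Y, exists x : X, Phi x = y) /\
    limf_einf (fun x : X => (A x (Phi x) / `|x|)%:E) (@norm_pinfty X) = +oo%E.

Lemma linearly_mapped_coerciveP (X Y : normedModType R) (A : X -> dual Y) :
  linearly_mapped_coercive A <->
  exists Phi : blin X Y, (forall y : Y, exists x : X, Phi x = y) /\
    forall K : R, 0 < K -> exists2 r : R, 0 < r &
      forall x : X, r <= `|x| -> K * `|x| <= A x (Phi x).
Proof.
suff H (Phi : blin X Y) :
    limf_einf (fun x : X => (A x (Phi x) / `|x|)%:E) (@norm_pinfty X) = +oo%E
    <-> forall K : R, 0 < K -> exists2 r : R, 0 < r &
      forall x : X, r <= `|x| -> K * `|x| <= A x (Phi x).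
  by split=> -[Phi [sPhi /H cPhi]]; exists Phi.
rewrite limf_einfE; split=> [supy K K0|cPhi].
  have : (K%:E < ereal_sup [set ereal_inf [set (A x (Phi x) / `|x|)%:E | x in P]
      | P in @norm_pinfty X])%E by rewrite supy ltry.
  move=> /ereal_sup_gt[_ [P /pinfty_ex_gt0[r r0 rP] <-] KP].
  exists r => // x rx; have x0 : 0 < `|x| by exact: lt_le_trans rx.
  rewrite -ler_pdivlMr// -lee_fin (le_trans (ltW KP))//.
  by apply: ereal_inf_lbound; exists x => //; exact: rP.
apply/eqyP => K /cPhi[r r0 rK]; apply: le_trans (ereal_sup_ubound _); last first.
  exists [set x | r <= `|x|] => //; apply: filterS (nbhs_pinfty_ge (num_real r)).
  by move=> s /= rs x; exact: le_trans.
apply: le_ereal_inf_tmp => _ [x /= rx <-].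
rewrite lee_fin ler_pdivlMr; first exact: rK.
exact: lt_le_trans rx.
Qed.

End Operators.

(* Main.v *)
Require Import Defs.
From mathcomp Require Import all_boot all_order all_algebra fingroup perm.
From mathcomp Require Import all_classical all_reals all_analysis.
From mathcomp Require Import ring lra zify.

Set Implicit Arguments.
Unset Strict Implicit.
Unset Printing Implicit Defensive.

Import Order.TTheory GRing.Theory Num.Theory.
Import numFieldNormedType.Exports.

Local Open Scope classical_set_scope.
Local Open Scope ring_scope.

(** The solution is obtained by the Galerkin method.  Let e_0, e_1, ... be dense
    in X, and let Phi be the surjection given by coercivity.  On a sphere
    `|x| = r of large radius, <A x - b, Phi x> > 0.  Restricted to a
    finite-dimensional space containing e_0, ..., e_(k-1), and tested only
    against the images by Phi of a basis of this space, the equation A x = b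
    becomes a system of as many continuous real equations as unknowns which
    satisfies the acute angle condition on that sphere, so it has a solution
    x_k with `|x_k| <= r ([galerkin_solution]).  Since X is reflexive and
    separable, a subfamily of the x_k converges weakly to some x
    ([weak_compactness]); weak continuity of A gives <A x - b, Phi e_i> = 0 for
    every i, hence <A x - b, Phi v> = 0 for every v by density, and A x = b
    because Phi is onto.

    Two classical theorems carry this argument.

    The finite-dimensional zero ([acute_angle]) is a form of Brouwer's theorem.
    It is deduced from the Poincare-Miranda theorem on a cube, itself a limit of
    a combinatorial statement ([cubical_sperner]): in a grid of side N whose
    vertices carry n binary labels, the m-th label being 0 on the face x_m = 0
    and 1 on the face x_m = N, some unit cell has both values of every label
    among its corners.  The proof is a discrete degree argument.  Sum over the
    simplices of the Kuhn triangulation the oriented volume of the image of the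
    simplex under the labelling, that is a determinant.  Changing one label
    function in the interior of the grid does not change the sum, because the
    variation is a sum over faces in which interior faces cancel in pairs and
    boundary faces contribute nothing ([kuhn_degree0]).  Moving to the labelling
    x |-> (x_m > 0)_m, one label at a time, gives the value n! for the sum.  It
    is not 0, so some simplex has a nonzero determinant, and on that simplex no
    label is constant.

    Weak compactness uses the Hahn-Banach theorem, obtained from Zorn's lemma
    applied to graphs of partial functionals.  An ultrafilter limit of
    f |-> f (x_n) is an element of the bidual, hence is evaluation at some x by
    reflexivity.  To replace the ultrafilter by a sequence, indices k_n are
    chosen so that f (x_(k_n)) tends to f x for countably many functionals which
    norm a dense sequence of X; a functional for which this convergence fails
    would be separated from those for which it holds by an element of the
    bidual, that is by a vector z on which all the norming functionals vanish,
    and then z = 0. *)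

(** * The degree of a labelling of the Kuhn triangulation *)

Section KuhnCube.
Variables (n N : nat).
Implicit Types (a : {ffun 'I_n -> 'I_N}) (s : 'S_n).
(* Row ord0 of F is meant to be the constant 1, so that the determinants below
   are affine volumes; row lift ord0 m is the label function attached to the
   coordinate m. *)
Implicit Types (F : 'I_n.+1 -> ('I_n -> nat) -> int).

(** The simplices of the Kuhn triangulation are the monotone paths from the
    corner a of a unit cube to the opposite one; s m is the rank of the step in
    direction m. *)
Definition kuhn_vertex a s (k : nat) : 'I_n -> nat :=
  fun m => (a m + (s m < k))%N.

Definition label_mx F a s : 'M[int]_n.+1 :=
  \matrix_(i, k) F i (kuhn_vertex a s k).

Definition kuhn_degree F : int :=
  \sum_(s : 'S_n) \sum_a (-1) ^+ s * \det (label_mx F a s).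

Definition face a s (i : 'I_n.+1) : 'I_n -> 'I_n -> nat :=
  fun k => kuhn_vertex a s (lift i k).

(** The (n-1)-cochain whose coboundary, up to sign, is the determinant of
    [label_mx].  Symmetrizing over all the vertices of the face, instead of
    evaluating row j at one of them, makes the weight independent of their
    order up to the sign of the determinant. *)
Definition face_weight F (j : 'I_n.+1) (w : 'I_n -> 'I_n -> nat) : int :=
  (\sum_k F j (w k)) * \det (\matrix_(r, k) F (lift j r) (w k)).

(** Expand the determinant along row j as sum_k M_jk C_k.  The cofactors C_k add
    up to 0, being the expansion of a determinant whose rows 0 and j are both
    equal to 1.  Hence the determinant is also - sum_i (sum_k M_jk - M_ji) C_i,
    and now the i-th term does not involve the vertex i: it lives on a face. *)
Lemma det_label_faces F a s (j : 'I_n.+1) : (forall x, F ord0 x = 1) ->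
  j != ord0 ->
  \det (label_mx F a s) =
  - \sum_(i < n.+1) (-1) ^+ (j + i) * face_weight F j (face a s i).
Proof.
move=> F1 j0; set M := label_mx F a s.
have cof0 : \sum_k cofactor M j k = 0.
  have := mul_mx_adj M => /matrixP/(_ ord0 j); rewrite !mxE eq_sym (negbTE j0).
  rewrite mulr0n => M0; rewrite -[RHS]M0; apply: eq_bigr => k _.
  by rewrite !mxE F1 mul1r.
have -> : \sum_(i < n.+1) (-1) ^+ (j + i) * face_weight F j (face a s i) =
    \sum_(i < n.+1) (\sum_k M j k - M j i) * cofactor M j i.
  apply: eq_bigr => i _; rewrite (bigD1_ord i)//= addrC addrK mulrCA.
  congr (_ * _).
    by apply: eq_bigr => k _; rewrite mxE.
  rewrite /cofactor; congr (_ * \det _).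
  by apply/matrixP => r k; rewrite !mxE.
rewrite (expand_det_row M j) -sumrN.
transitivity (\sum_(i < n.+1) (\sum_k M j k) * cofactor M j i -
  \sum_(i < n.+1) (\sum_k M j k - M j i) * cofactor M j i).
  by rewrite -sumrB; apply: eq_bigr => i _; ring.
by rewrite -mulr_sumr cof0 mulr0 sub0r sumrN.
Qed.

(** Exchanging the steps of ranks i-1 and i replaces the simplex by its
    neighbour across the face opposite to the vertex i, which has opposite
    orientation. *)
Lemma interior_faces_cancel F (j i : 'I_n.+1) : (0 < i < n)%N ->
  \sum_(s : 'S_n) \sum_a (-1) ^+ s * face_weight F j (face a s i) = 0.
Proof.
move=> /andP[i0 iN].
have i1 : (i.-1 < n)%N by rewrite (leq_ltn_trans (leq_pred _)).
pose t : 'S_n := tperm (Ordinal i1) (Ordinal iN).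
have tne : Ordinal i1 != Ordinal iN.
  by rewrite -val_eqE /= -{2}(prednK i0) neq_ltn leqnn.
set S := LHS; suff : S = - S by move=> /eqP; lia.
rewrite {1}/S (reindex_inj (mulIg t)) /= -sumrN; apply: eq_bigr => s _.
rewrite -sumrN; apply: eq_bigr => a _.
rewrite odd_permM odd_tperm tne addbT signrN mulNr; congr (- (_ * _)).
suff -> : face a (s * t)%g i = face a s i by [].
apply/funext => k; apply/funext => m; rewrite /face /kuhn_vertex permM.
congr (_ + _)%N; congr nat_of_bool.
have : lift i k != i :> nat by rewrite eq_sym neq_bump.
case: (tpermP (Ordinal i1) (Ordinal iN) (s m)) => [->|->|//] /=; lia.
Qed.

(** Row j is the difference of two label functions with the same boundary
    values, the other rows being proper labels. *)
Definition boundary_vanishing F (j : 'I_n.+1) :=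
  (forall x, F ord0 x = 1) /\
  forall (m : 'I_n) x, x m = 0%N \/ x m = N ->
    F (lift ord0 m) x = if lift ord0 m == j then 0 else (0 < x m)%N%:R.

(** On a face of the cube, row j vanishes if the face is orthogonal to
    the direction of j; otherwise some other row is constant, thus
    proportional to row 0. *)
Lemma face_weight_boundary F j (w : 'I_n -> 'I_n -> nat) (m : 'I_n) c :
  j != ord0 -> boundary_vanishing F j -> c = 0%N \/ c = N ->
  (forall k, w k m = c) -> face_weight F j w = 0.
Proof.
move=> j0 [F1 Fb] c0N wc; rewrite /face_weight.
have Fw k :
    F (lift ord0 m) (w k) = if lift ord0 m == j then 0 else (0 < c)%N%:R.
  by rewrite Fb ?wc.
have [mj|mj] := eqVneq (lift ord0 m) j.
  by rewrite big1 ?mul0r// => k _; rewrite -mj Fw mj eqxx.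
have [r1 r1E] : exists r, lift ord0 m = lift j r.
  case: (unliftP j (lift ord0 m)) mj => [r -> _|->]; first by exists r.
  by rewrite eqxx.
have [r0 r0E] : exists r, ord0 = lift j r.
  case: (unliftP j ord0) j0 => [r -> _|->]; first by exists r.
  by rewrite eqxx.
apply/eqP; rewrite mulf_eq0; apply/orP; right; apply/eqP.
have [c0|cp] := posnP c.
  rewrite (expand_det_row _ r1) big1// => k _.
  by rewrite mxE -r1E Fw (negbTE mj) c0 mul0r.
have r01 : r0 != r1.
  by apply: contraNneq (neq_lift ord0 m) => r01; rewrite r1E -r01 -r0E.
apply: (determinant_alternate r01) => k.
by rewrite !mxE -r0E -r1E F1 Fw (negbTE mj) cp.
Qed.
End KuhnCube.

Section KuhnEnds.
Variables (p q : nat).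
Let n := p.+1.
Let N := q.+1.
Implicit Types (a : {ffun 'I_n -> 'I_N}) (s : 'S_n).
Implicit Types (F : 'I_n.+1 -> ('I_n -> nat) -> int).

(* Multiplication by [cycp] makes the first step of a path the last one: the
   face opposite to the first vertex of a simplex is the face opposite to the
   last vertex of the path started one step later. *)
Let cycp : 'S_n := lift_perm ord0 ord_max 1.

(* Addition of 1 modulo N, so that the shift is a bijection of all the cells.  A
   face which is wrapped around lies on the boundary, before and after. *)
Let shift (m0 : 'I_n) a : {ffun 'I_n -> 'I_N} :=
  [ffun m => if m == m0 then ordS (a m) else a m].

Let shift_inj m0 : injective (shift m0).
Proof.
move=> a b /ffunP ab; apply/ffunP => m; have := ab m; rewrite !ffunE.
by case: ifP => // _; apply: (can_inj (@ordSK _)).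
Qed.

Let cycp_sign s : (-1) ^+ (s * cycp)%g = (-1) ^+ p * (-1) ^+ s :> int.
Proof.
rewrite odd_permM odd_lift_perm odd_perm1/= addbF signr_addb mulrC.
by rewrite signr_odd.
Qed.

Let end_faces F (j : 'I_n.+1) (m0 : 'I_n) a s :
  j != ord0 -> boundary_vanishing N F j -> s m0 = ord0 ->
  face_weight F j (face (shift m0 a) (s * cycp)%g ord_max) =
  face_weight F j (face a s ord0).
Proof.
move=> j0 Fb sm0; have s'm0 : (s * cycp)%g m0 = ord_max.
  by rewrite permM sm0 lift_perm_id.
have [aq|aq] := eqVneq (a m0 : nat) q.
  rewrite (face_weight_boundary (m := m0) (c := 0) j0 Fb).
  - rewrite (face_weight_boundary (m := m0) (c := N) j0 Fb) //; first by right.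
    by move=> k; rewrite /face /kuhn_vertex sm0 aq /= addn1.
  - by left.
  move=> k; rewrite /face /kuhn_vertex s'm0 lift_max ffunE eqxx /= aq modnn.
  by rewrite /= ltnNge -ltnS ltn_ord.
congr face_weight; apply/funext => k; apply/funext => m.
rewrite /face /kuhn_vertex lift_max ffunE; have [->|mm0] := eqVneq m m0.
  rewrite s'm0 sm0 /= modn_small.
    by rewrite ltnNge -ltnS ltn_ord addn0 addn1.
  by rewrite ltnS ltn_neqAle aq -ltnS ltn_ord.
congr (_ + _)%N; rewrite permM.
case: (unliftP ord0 (s m)) => [r ->|smE].
  by rewrite lift_perm_lift perm1 lift_max !lift0 ltnS.
by move: mm0; rewrite -(inj_eq (@perm_inj _ s)) smE sm0 eqxx.
Qed.

Lemma end_faces_cancel F (j : 'I_n.+1) :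
  j != ord0 -> boundary_vanishing N F j ->
  \sum_(s : 'S_n) \sum_(a : {ffun 'I_n -> 'I_N})
    (-1) ^+ s * face_weight F j (face a s ord_max) =
  (-1) ^+ p *
  \sum_(s : 'S_n) \sum_(a : {ffun 'I_n -> 'I_N})
    (-1) ^+ s * face_weight F j (face a s ord0).
Proof.
move=> j0 Fb; rewrite (reindex_inj (mulIg cycp)) /= mulr_sumr.
apply: eq_bigr => s _; pose m0 := (s^-1)%g ord0.
have sm0 : s m0 = ord0 by rewrite /m0 permKV.
rewrite (reindex_inj (@shift_inj m0)) /= mulr_sumr; apply: eq_bigr => a _.
by rewrite cycp_sign (end_faces a j0 Fb sm0) mulrA.
Qed.

(** Discrete Stokes formula: the degree is a sum over faces, in which each
    interior face appears twice with opposite signs and the boundary faces have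
    weight 0. *)
Lemma kuhn_degree0 F (j : 'I_n.+1) : j != ord0 -> boundary_vanishing N F j ->
  kuhn_degree N F = 0.
Proof.
move=> j0 Fb; rewrite /kuhn_degree.
transitivity (- \sum_(i < n.+1) (-1) ^+ (j + i) *
    \sum_(s : 'S_n) \sum_(a : {ffun 'I_n -> 'I_N})
      (-1) ^+ s * face_weight F j (face a s i)).
  rewrite -sumrN.
  under [RHS]eq_bigr do rewrite -mulrN -sumrN mulr_sumr.
  rewrite [RHS]exchange_big /=; apply: eq_bigr => s _.
  under [RHS]eq_bigr do rewrite -sumrN mulr_sumr.
  rewrite [RHS]exchange_big /=; apply: eq_bigr => a _.
  rewrite (det_label_faces a s Fb.1 j0) mulrN mulr_sumr -sumrN.
  by apply: eq_bigr => i _; rewrite mulrN mulrCA.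
rewrite big_ord_recl big_ord_recr /=.
rewrite [X in _ + (X + _)]big1 => [|i _]; last first.
  by rewrite interior_faces_cancel ?mulr0 //= /bump /= ltnS.
have -> : lift ord0 ord_max = ord_max :> 'I_n.+1 by exact/val_inj.
rewrite (end_faces_cancel j0 Fb) add0r.
set T := \sum_s _; rewrite !exprD /= !expr0 !mulr1 ?mulN1r.
rewrite ?exprS ?mulN1r mulrN mulNr.
by rewrite mulrA -[_ * _ * (-1) ^+ p]mulrA -expr2 sqrr_sign mulr1 subrr oppr0.
Qed.

Definition proper_labels F :=
  (forall x, F ord0 x = 1) /\
  forall (m : 'I_n) x, x m = 0%N \/ x m = N ->
    F (lift ord0 m) x = (0 < x m)%N%:R.

(** The degree is multilinear in the rows, and the difference of the two
    labellings in row j vanishes on the boundary. *)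
Lemma kuhn_degree_replace F F' (j : 'I_n.+1) : j != ord0 ->
  proper_labels F -> proper_labels F' ->
  (forall i, i != j -> F i = F' i) -> kuhn_degree N F = kuhn_degree N F'.
Proof.
move=> j0 [F1 Fb] [F'1 F'b] FF'.
pose D i x := if i == j then F i x - F' i x else F i x.
have Db : boundary_vanishing N D j.
  split=> [x|m x xb]; first by rewrite /D eq_sym (negbTE j0) F1.
  by rewrite /D; case: eqP => _; rewrite !Fb// F'b// subrr.
have := kuhn_degree0 j0 Db; rewrite /kuhn_degree => D0.
apply/eqP; rewrite -subr_eq0 -[X in _ == X]D0; apply/eqP.
rewrite -sumrB; apply: eq_bigr => s _; rewrite -sumrB; apply: eq_bigr => a _.
rewrite -mulrBr; congr (_ * _).
suff : \det (label_mx F a s) =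
    1 * \det (label_mx F' a s) + 1 * \det (label_mx D a s).
  by rewrite !mul1r => ->; rewrite [LHS]addrC addKr.
apply: (@determinant_multilinear _ _ _ _ _ j).
- by apply/rowP => k; rewrite !mxE /D eqxx !mul1r addrC subrK.
- by apply/matrixP => i k; rewrite !mxE FF'// eq_sym neq_lift.
- by apply/matrixP => i k; rewrite !mxE /D eq_sym (negbTE (neq_lift _ _)).
Qed.

(** The reference labelling x |-> (x_m > 0)_m, which is proper since N > 0. *)
Definition coordinate_labels (i : 'I_n.+1) (x : 'I_n -> nat) : int :=
  if unlift ord0 i is Some m then (0 < x m)%N%:R else 1.

Lemma coordinate_labelsS m x :
  coordinate_labels (lift ord0 m) x = (0 < x m)%N%:R.
Proof. by rewrite /coordinate_labels liftK. Qed.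

Lemma coordinate_labels_proper : proper_labels coordinate_labels.
Proof.
by split=> [x|m x _]; [rewrite /coordinate_labels unlift_none|
  rewrite coordinate_labelsS].
Qed.

(* In the cube at the origin, the label m is 1 exactly after the step of
   rank s m: up to the permutation s of the rows, the matrix is upper
   unitriangular. *)
Let label_mx_coord0 s :
  \det (label_mx coordinate_labels [ffun=> ord0 : 'I_N] s) = (-1) ^+ s.
Proof.
pose U : 'M[int]_n.+1 := \matrix_(i, k) (i <= k)%N%:R.
have -> : label_mx coordinate_labels [ffun=> ord0 : 'I_N] s =
    row_perm (lift_perm ord0 ord0 s) U.
  apply/matrixP => i k; rewrite !mxE.
  case: (unliftP ord0 i) => [m ->|->].
    rewrite coordinate_labelsS lift_perm_lift /kuhn_vertex ffunE add0n lt0b.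
    by rewrite lift0.
  by rewrite coordinate_labels_proper.1 lift_perm_id.
rewrite row_permE det_mulmx det_perm odd_lift_perm /= -det_tr.
rewrite det_trig; last first.
  by apply/is_trig_mxP => i k ik; rewrite !mxE leqNgt ik.
by rewrite big1 ?mulr1// => i _; rewrite !mxE leqnn.
Qed.

(** A cell with a positive coordinate m has the label m constantly equal to 1,
    so only the cube at the origin contributes, and each of its n! simplices
    contributes 1. *)
Lemma kuhn_degree_coordinate : kuhn_degree N coordinate_labels = n`!%:R.
Proof.
rewrite /kuhn_degree -card_Sn -sumr_const.
apply: eq_bigr => s _; rewrite (bigD1 [ffun=> ord0])//= label_mx_coord0.
rewrite -expr2 sqrr_sign big1 ?addr0// => a a0.
have [m am] : exists m, a m != ord0.
  apply/existsP; apply: contraNT a0; rewrite negb_exists => /forallP a0.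
  apply/eqP/ffunP => m.
  by rewrite ffunE; have := a0 m; rewrite negbK => /eqP.
rewrite (determinant_alternate (neq_lift ord0 m)) ?mulr0// => k.
rewrite !mxE coordinate_labels_proper.1 coordinate_labelsS.
by rewrite /kuhn_vertex addn_gt0 lt0n; move: am; rewrite -val_eqE /= => ->.
Qed.

(** Any proper labelling is transformed into the reference one by replacing
    one row after another; H r is the labelling after r replacements. *)
Lemma kuhn_degree_proper F : proper_labels F -> kuhn_degree N F = n`!%:R.
Proof.
move=> [F1 Fb]; pose H r i x :=
  if unlift ord0 i is Some m then
    if (m < r)%N then coordinate_labels i x else F i x
  else 1 : int.
have HS r m x : H r (lift ord0 m) x =
    if (m < r)%N then (0 < x m)%N%:R else F (lift ord0 m) x.
  by rewrite /H liftK coordinate_labelsS.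
have Hp r : proper_labels (H r).
  split=> [x|m x xb]; first by rewrite /H unlift_none.
  by rewrite HS Fb ?if_same.
have HF r : (r <= n)%N -> kuhn_degree N (H r) = kuhn_degree N F.
  elim: r => [_|r IH rn].
    congr kuhn_degree; apply/funext => i; apply/funext => x.
    by case: (unliftP ord0 i) => [m ->|->]; rewrite ?HS// /H unlift_none F1.
  rewrite -IH; last exact: ltnW.
  apply: (@kuhn_degree_replace _ _ (lift ord0 (Ordinal rn))) => // i ir.
  apply/funext => x; move: ir; case: (unliftP ord0 i) => [m ->|->].
    rewrite (inj_eq lift_inj) -val_eqE /= !HS ltnS leq_eqVlt => /negbTE ->.
    by [].
  by rewrite /H unlift_none.
rewrite -(HF n)// -kuhn_degree_coordinate; congr kuhn_degree.
apply/funext => i; apply/funext => x.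
case: (unliftP ord0 i) => [m ->|->].
  by rewrite HS ltn_ord coordinate_labelsS.
by rewrite /H /coordinate_labels unlift_none.
Qed.
End KuhnEnds.

(** A simplex with nonzero determinant exists because the degree is n!.  A label
    which is constant on it would give a zero row or a row equal to row 0. *)
Lemma cubical_sperner n N (F : 'I_n -> ('I_n -> nat) -> bool) : (0 < N)%N ->
  (forall m x, x m = 0%N -> ~~ F m x) -> (forall m x, x m = N -> F m x) ->
  exists2 y : 'I_n -> nat, forall i, (y i < N)%N &
    forall m (b : bool), exists2 z : 'I_n -> nat,
      forall i, (y i <= z i <= (y i).+1)%N & F m z = b.
Proof.
case: n F => [F _ _ _|p F]; first by exists (fun=> 0%N) => [] [].
case: N => // q _ F0 FN.
pose G (i : 'I_p.+2) x : int :=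
  if unlift ord0 i is Some m then (F m x)%:R else 1.
have GS m x : G (lift ord0 m) x = (F m x)%:R by rewrite /G liftK.
have G1 x : G ord0 x = 1 by rewrite /G unlift_none.
have Gp : proper_labels q G.
  split=> [x|m x]; first exact: G1.
  rewrite GS => -[|] xm; first by rewrite (negbTE (F0 _ _ xm)) xm.
  by rewrite FN// xm.
have : kuhn_degree q.+1 G != 0.
  by rewrite (kuhn_degree_proper Gp) pnatr_eq0 -lt0n fact_gt0.
rewrite /kuhn_degree => /eqP dG0.
have [s [a das]] : exists s, exists a : {ffun 'I_p.+1 -> 'I_q.+1},
    \det (label_mx G a s) <> 0.
  apply: contrapT => nd; apply: dG0.
  rewrite big1// => s _; rewrite big1// => a _.
  have [->|d0] := eqVneq (\det (label_mx G a s)) 0; first by rewrite mulr0.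
  by exfalso; apply: nd; exists s, a; exact/eqP.
exists (fun i => a i) => // m b.
apply: contrapT => nb; apply: das.
have Fm k : F m (kuhn_vertex a s k) = ~~ b.
  have [Fb|] := eqVneq (F m (kuhn_vertex a s k)) b; last first.
    by case: b (F _ _) {nb} => -[].
  exfalso; apply: nb; exists (kuhn_vertex a s k) => // i.
  by rewrite /kuhn_vertex; case: (_ < _)%N; lia.
case: b Fm {nb} => Fm.
  rewrite (expand_det_row _ (lift ord0 m)) big1// => k _.
  by rewrite mxE GS Fm mul0r.
rewrite (determinant_alternate (neq_lift ord0 m))// => k.
by rewrite !mxE GS Fm G1.
Qed.

(** * Zeros of continuous maps on R^n *)

Section PoincareMiranda.
Context {R : realType} (n : nat).

Definition cube (M : R) : set 'rV[R]_n :=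
  [set x | forall i, -M <= x ord0 i <= M].

Lemma compact_cube M : compact (cube M).
Proof.
have := @rV_compact R n (fun=> `[-M, M]%classic) (fun=> @segment_compact _ _ _).
by under eq_set do under eq_forall do rewrite /= in_itv /=.
Qed.

(** Label the vertices of the grid of step 2M/(p+1) in the cube by the signs of
    the G m.  The cells given by [cubical_sperner] accumulate at some x as p
    grows; each G m takes both signs at points arbitrarily close to x, hence
    vanishes at x. *)
Theorem poincare_miranda (M : R) (G : 'I_n -> 'rV[R]_n -> R) : 0 < M ->
  (forall i, continuous (G i)) ->
  (forall i x, cube M x -> x ord0 i = M -> 0 <= G i x) ->
  (forall i x, cube M x -> x ord0 i = - M -> G i x <= 0) ->
  exists x, forall i, G i x = 0.
Proof.
move=> M0 cG GM GN.
pose pos (p : nat) (z : 'I_n -> nat) : 'rV[R]_n :=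
  \row_i (- M + 2 * M / p.+1%:R * (z i)%:R).
have posE p z i : pos p z ord0 i = - M + 2 * M / p.+1%:R * (z i)%:R.
  by rewrite mxE.
have step0 (p : nat) : 0 < 2 * M / p.+1%:R by rewrite divr_gt0 ?mulr_gt0.
have pos_cube p z : (forall i, (z i <= p.+1)%N) -> cube M (pos p z).
  move=> zp i; rewrite posE; apply/andP; split.
    by rewrite lerDl mulr_ge0// ltW.
  have : 2 * M / p.+1%:R * (z i)%:R <= 2 * M / p.+1%:R * p.+1%:R.
    by rewrite ler_wpM2l ?ler_nat// ltW.
  rewrite divfK ?pnatr_eq0//; set t := _ * (z i)%:R => tM; lra.
have /choice[y yP] : forall p, exists y : 'I_n -> nat,
    (forall i, (y i < p.+1)%N) /\
    forall m (b : bool), exists2 z : 'I_n -> nat,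
      forall i, (y i <= z i <= (y i).+1)%N &
      if b then 0 <= G m (pos p z) else G m (pos p z) <= 0.
  (* The labels are forced on the two faces orthogonal to m, where G m may
     vanish; the hypotheses on G make the forced values correct. *)
  move=> p; pose F m (z : 'I_n -> nat) :=
    (z m == p.+1) || ((0 < z m)%N && (0 <= G m (pos p z))).
  have [//|m x xm|m x xm|y yp yF] := @cubical_sperner n p.+1 F.
  - by rewrite /F xm.
  - by rewrite /F xm eqxx.
  exists y; split=> // m b; have [z yz Fz] := yF m b; exists z => //.
  have zp i : (z i <= p.+1)%N by have := yz i; have := yp i; lia.
  case: b Fz => [/orP[/eqP zm|/andP[]//]|/negbT].
    apply: GM; first exact: pos_cube.
    by rewrite posE zm divfK ?pnatr_eq0//; lra.
  rewrite negb_or negb_and => /andP[_ /orP[|]].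
    rewrite -eqn0Ngt => /eqP zm; apply: GN; first exact: pos_cube.
    by rewrite posE zm mulr0 addr0.
  by rewrite -ltNge => /ltW.
have [x [_ clx]] : cube M `&` cluster ((fun p => pos p (y p)) @ \oo) !=set0.
  apply: compact_cube; exists 0%N => // p _ /=.
  by apply: pos_cube => i; rewrite ltnW// (yP p).1.
suff sgn m (b : bool) : if b then 0 <= G m x else G m x <= 0.
  by exists x => m; apply/eqP; rewrite eq_le (sgn m false) (sgn m true).
apply: contrapT => Gb.
have /nbhs_ballP[e /= e0 eG] : \forall x' \near x,
    ~ (if b then 0 <= G m x' else G m x' <= 0).
  case: b Gb => /negP; rewrite -ltNge => Gx.
    near=> x'; apply/negP; rewrite -ltNge; near: x'.
    exact: cvgr_lt (cG m x) _ Gx.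
  near=> x'; apply/negP; rewrite -ltNge; near: x'.
  exact: cvgr_gt (cG m x) _ Gx.
have e20 : 0 < e / 2 by rewrite divr_gt0.
have [|_ [[p /= pe <-] xyp]] := clx
    ((fun p => pos p (y p)) @` [set p | 2 * M / p.+1%:R < e / 2])
    (ball x (e / 2)) _ (nbhsx_ballx _ _ e20).
  have eM0 : 0 < e / 2 / (2 * M) by rewrite divr_gt0// mulr_gt0.
  have [p0 _ p0P] := near_infty_natSinv_lt (PosNum eM0).
  exists p0 => // p p0p; exists p => //=.
  by rewrite mulrC -ltr_pdivlMr ?mulr_gt0//; exact: p0P.
have [z yz Gz] := (yP p).2 m b.
apply: (eG (pos p z)) => //; split=> // i j.
have [_ /(_ i j)] := xyp; rewrite /ball /= !ord1 !posE => xy.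
rewrite (le_lt_trans (ler_distD (pos p (y p) 0 j) _ _))// posE.
suff : `|- M + 2 * M / p.+1%:R * (y p j)%:R -
        (- M + 2 * M / p.+1%:R * (z j)%:R)| <= 2 * M / p.+1%:R.
  by move: pe xy; set t := 2 * M / _; set a := `|_|; set b0 := `|_|; lra.
rewrite opprD addrACA subrr add0r -mulrBr normrM gtr0_norm//.
rewrite ler_piMr ?(ltW (step0 p))// distrC -natrB; last by have /andP[] := yz j.
by rewrite ger0_norm// (ler_nat _ _ 1); have := yz j; lia.
Unshelve. all: by end_near. Qed.
End PoincareMiranda.

(** * Finite-dimensional subspaces *)

Section LinearCombination.
Context {R : realType} {X : normedModType R}.

Lemma continuous_norm_comp (T : topologicalType) (V : normedModType R)
    (f : T -> V) :
  continuous f -> continuous (fun x => `|f x|).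
Proof. by move=> cf x; apply: cvg_norm; exact: cf. Qed.

Definition lin_comb n (f : 'I_n -> X) (c : 'rV[R]_n) : X :=
  \sum_i c ord0 i *: f i.

Lemma lin_combZ n (f : 'I_n -> X) a c :
  lin_comb f (a *: c) = a *: lin_comb f c.
Proof.
by rewrite /lin_comb scaler_sumr; apply: eq_bigr => i _; rewrite mxE scalerA.
Qed.

Lemma lin_comb_delta n (f : 'I_n -> X) i : lin_comb f (delta_mx ord0 i) = f i.
Proof.
rewrite /lin_comb (bigD1 i)//= mxE !eqxx scale1r big1 ?addr0// => j ji.
by rewrite mxE (negbTE ji) andbF scale0r.
Qed.

Lemma continuous_lin_comb n (f : 'I_n -> X) : continuous (lin_comb f).
Proof.
apply: continuous_big => [|i _ c]; first exact: add_continuous.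
exact: (cvgZr_tmp (@coord_continuous R 1 n ord0 i c)).
Qed.

Definition lin_indep n (f : 'I_n -> X) := forall c, lin_comb f c = 0 -> c = 0.

Lemma coord_le_norm n (c : 'rV[R]_n) i : `|c ord0 i| <= `|c|.
Proof.
rewrite [leRHS]/Num.norm /= mx_normrE.
by apply/bigmax_geP; right; exists (ord0, i).
Qed.

(** All norms on R^n are equivalent: the norm of the combination has a positive
    minimum on the unit sphere. *)
Lemma lin_indep_coercive n (f : 'I_n -> X) : lin_indep f ->
  exists2 d : R, 0 < d & forall c, d * `|c| <= `|lin_comb f c|.
Proof.
move=> f0; have [[c0 c00]|n0] := pselect (exists c0 : 'rV[R]_n, c0 != 0);
    last first.
  exists 1 => // c; have [->|c0] := eqVneq c 0; first by rewrite normr0 mulr0.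
  by exfalso; apply: n0; exists c.
pose S : set 'rV[R]_n := [set c | `|c| = 1].
have nc c : c != 0 -> S (`|c|^-1 *: c).
  move=> cn0; rewrite /S /= normrZ gtr0_norm ?invr_gt0 ?normr_gt0//.
  by rewrite mulVf// normr_eq0.
have cS : compact S.
  apply: bounded_closed_compact.
    by exists 1; split=> // M M1 c /= ->; exact: ltW.
  have -> : S = (fun c : 'rV[R]_n => `|c|) @^-1` [set x | x = 1] by [].
  by apply: preimage_closed => [c _|];
    [exact: norm_continuous | exact: closed_eq].
have [c cS0 cmin] : exists2 c, c \in S &
    forall t, t \in S -> `|lin_comb f c| <= `|lin_comb f t|.
  apply: EVT_min_rV => //; first by exists (`|c0|^-1 *: c0); exact: nc.
  exact/continuous_subspaceT/continuous_norm_comp/continuous_lin_comb.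
exists `|lin_comb f c|.
  rewrite normr_gt0; apply/eqP => /f0 c_0; move: cS0.
  rewrite inE /S /= c_0 normr0.
  by move=> /eqP; rewrite eq_sym oner_eq0.
move=> t; have [->|t0] := eqVneq t 0; first by rewrite normr0 mulr0.
have /cmin : `|t|^-1 *: t \in S by rewrite inE; exact: nc.
rewrite lin_combZ normrZ gtr0_norm ?invr_gt0 ?normr_gt0//.
by rewrite ler_pdivlMl ?normr_gt0// mulrC.
Qed.

(** Independence is what makes the coordinates of bounded combinations bounded,
    so redundant vectors are dropped from the family. *)
Lemma lin_indep_span (e : nat -> X) k : exists n (f : 'I_n -> X),
  lin_indep f /\ forall i, (i < k)%N -> exists c, e i = lin_comb f c.
Proof.
elim: k => [|k [n [f [f0 fe]]]].
  by exists 0%N, (fun=> 0); split=> // c _; apply/rowP => -[].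
have [[c ek]|nek] := pselect (exists c, e k = lin_comb f c).
  exists n, f; split=> // i; rewrite ltnS leq_eqVlt => /predU1P[->|/fe//].
  by exists c.
pose g (i : 'I_n.+1) := if unlift ord_max i is Some j then f j else e k.
have gE c : lin_comb g c =
    c ord0 ord_max *: e k + lin_comb f (\row_j c ord0 (lift ord_max j)).
  rewrite /lin_comb (bigD1_ord ord_max)//= /g unlift_none; congr (_ + _).
  by apply: eq_bigr => j _; rewrite liftK mxE.
exists n.+1, g; split=> [c|i].
  rewrite gE => c0; have cm : c ord0 ord_max = 0.
    apply: contrapT => /eqP cm; apply: nek.
    exists (- (c ord0 ord_max)^-1 *: (\row_j c ord0 (lift ord_max j))).
    rewrite lin_combZ -(addrK (c ord0 ord_max *: e k) (lin_comb f _)).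
    rewrite [_ + _ *: e k]addrC c0 sub0r scalerN scaleNr opprK scalerA.
    by rewrite mulVf ?scale1r.
  move: c0; rewrite cm scale0r add0r => /f0/rowP c0.
  apply/rowP => i; rewrite [RHS]mxE; case: (unliftP ord_max i) => [j|] ->//.
  by have := c0 j; rewrite !mxE.
rewrite ltnS leq_eqVlt => /predU1P[->|/fe[c ->]].
  by exists (delta_mx ord0 ord_max); rewrite lin_comb_delta /g unlift_none.
exists (\row_i if unlift ord_max i is Some j then c ord0 j else 0).
rewrite gE mxE unlift_none scale0r add0r; congr lin_comb.
by apply/rowP => j; rewrite !mxE liftK.
Qed.

(** Compose F with the radial retraction c |-> s c *: c onto the ball of radius
    r, and add the displacement (1 - s c) *: c.  The first term is bounded, so
    the second one decides the signs on the faces of a large cube and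
    [poincare_miranda] gives a zero c of the sum.  Outside the ball, F would
    be a negative multiple of c at the retracted point, contradicting the
    hypothesis on the sphere; inside it, the displacement is 0. *)
Lemma acute_angle n (f : 'I_n -> X) (F : 'I_n -> X -> R) (r : R) : 0 < r ->
  lin_indep f -> (forall i, continuous (F i)) ->
  (forall c, `|lin_comb f c| = r -> 0 < \sum_i c ord0 i * F i (lin_comb f c)) ->
  exists2 c, `|lin_comb f c| <= r & forall i, F i (lin_comb f c) = 0.
Proof.
move=> r0 f0 cF Fr; set L := lin_comb f in Fr *.
have cL : continuous L by exact: continuous_lin_comb.
have cLn : continuous (fun c => `|L c|).
  exact: continuous_norm_comp.
have [d d0 dL] := lin_indep_coercive f0.
pose s c := r / Num.max r `|L c|.
have m0 c : 0 < Num.max r `|L c| by rewrite lt_max r0.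
have s0 c : 0 < s c by rewrite divr_gt0.
have s1 c : s c <= 1 by rewrite ler_pdivrMr// mul1r le_max lexx.
have Ls c : `|L (s c *: c)| <= r.
  rewrite /L lin_combZ -/L normrZ gtr0_norm// /s mulrAC ler_pdivrMr//.
  by rewrite ler_wpM2l ?(ltW r0)// le_max lexx orbT.
have ccst (k : R) : continuous (fun _ : 'rV[R]_n => k) by exact: cst_continuous.
have cs : continuous s.
  move=> c.
  refine (continuousM (s := cst r) (t := fun c => (Num.max r `|L c|)^-1)
    (ccst r c) _).
  refine (continuousV _ _); first by rewrite gt_eqF.
  exact: (continuous_max (f := cst r) (ccst r c) (cLn c)).
have csc : continuous (fun c => s c *: c).
  move=> c; have cid : continuous_at c (@id 'rV[R]_n) by [].
  exact: (continuousZ (f := id) (cs c) cid).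
have cFL i : continuous (F i \o L).
  by move=> c; apply: continuous_comp; [exact: cL|exact: cF].
pose K : set 'rV[R]_n := [set c | `|L c| <= r].
have cK : compact K.
  apply: bounded_closed_compact.
    exists (r / d); split; [exact: num_real|move=> M rM c /= Lc].
    rewrite (le_trans _ (ltW rM))//.
    by rewrite ler_pdivlMr// mulrC (le_trans (dL c)).
  have -> : K = (fun c => `|L c|) @^-1` [set x | x <= r] by [].
  by apply: preimage_closed => [c _|]; [exact: cLn | exact: closed_le].
have [cm cmK Fcm] : exists2 cm, cm \in K &
    forall c, c \in K -> \sum_i `|F i (L c)| <= \sum_i `|F i (L cm)|.
  apply: EVT_max_rV => //.
    by exists 0; rewrite /K /= /L -(scale0r 0) lin_combZ scale0r normr0 ltW.
  apply/continuous_subspaceT/continuous_big => [|i _].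
    exact: add_continuous.
  exact: (continuous_norm_comp (V := R^o) (cFL i)).
set C := \sum_i `|F i (L cm)| in Fcm.
have C0 : 0 <= C by rewrite sumr_ge0.
have FC i c : `|F i (L (s c *: c))| <= C.
  have /Fcm : s c *: c \in K by rewrite inE; exact: Ls.
  apply: le_trans; rewrite (bigD1 i)//= lerDl sumr_ge0//.
have sc i c : `|s c * c ord0 i| <= r / d.
  have -> : s c * c ord0 i = (s c *: c) ord0 i by rewrite mxE.
  rewrite (le_trans (coord_le_norm _ _))// ler_pdivlMr// mulrC.
  exact: le_trans (dL _) (Ls c).
(* On the face c_i = M the i-th component of the sum is at least
   - C + M - s c * c_i, and s c * c_i <= r / d. *)
pose M := C + r / d.
have M0 : 0 < M by rewrite ltr_wpDl// divr_gt0.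
pose G i c := F i (L (s c *: c)) + (1 - s c) * c ord0 i.
have cG i : continuous (G i).
  move=> c; refine (continuousD (f := fun c => F i (L (s c *: c))) _ _).
    exact: (continuous_comp (csc c) (cFL i _)).
  refine (continuousM (s := cst 1 - s) _ (@coord_continuous _ _ _ _ _ c)).
  exact: (continuousB (ccst 1 c) (cs c)).
have [i c _ cM|i c _ cM|c Gc] := poincare_miranda M0 cG.
- have := FC i c; have := sc i c; rewrite !ler_norml /G mulrBl mul1r cM /M; lra.
- have := FC i c; have := sc i c; rewrite !ler_norml /G mulrBl mul1r cM /M; lra.
have [Lr|Lr] := leP `|L c| r.
  have sc1 : s c = 1 by rewrite /s max_l// divff// gt_eqF.
  exists c => // i; have := Gc i.
  by rewrite /G sc1 subrr mul0r addr0 scale1r.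
have scE : s c = r / `|L c| by rewrite /s max_r// ltW.
have /Fr : `|L (s c *: c)| = r.
  rewrite /L lin_combZ -/L normrZ gtr0_norm// scE divfK// gt_eqF//.
  exact: lt_trans Lr.
rewrite ltNge => /negP; case; rewrite sumr_le0// => i _.
have -> : F i (L (s c *: c)) = - ((1 - s c) * c ord0 i).
  by apply/eqP; rewrite -addr_eq0; apply/eqP; exact: Gc.
rewrite mxE mulrN oppr_le0 mulrACA mulr_ge0//; last by rewrite -expr2 sqr_ge0.
by rewrite mulr_ge0 ?subr_ge0// ltW.
Qed.
End LinearCombination.

(** * The Hahn-Banach theorem *)

Section HahnBanach.
Context {R : realType} {V : normedModType R}.
Implicit Types (G H : set (V * R)).

(** A linear subspace of V * R satisfying the last condition is the graph of a
    functional of norm at most 1 on a subspace of V: if (0, t) belongs to it,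
    then t <= 0 and - t <= 0. *)
Definition dominated_graph G :=
  [/\ G (0, 0),
      forall a x t y u, G (x, t) -> G (y, u) -> G (a *: x + y, a * t + u) &
      forall x t, G (x, t) -> t <= `|x|].

(** The number a is a possible value at v of an extension. It exists since
    t - `|x - v| <= `|y + v| - u for all (x, t) and (y, u) in H, by the triangle
    inequality for x + y = (x - v) + (y + v). *)
Lemma dominated_graph_gap H v : dominated_graph H ->
  exists a : R, forall x t, H (x, t) -> t - `|x - v| <= a /\ a <= `|x + v| - t.
Proof.
move=> [H0 Hl Hd].
have gap x t y u : H (x, t) -> H (y, u) -> t - `|x - v| <= `|y + v| - u.
  move=> /(Hl 1)Hx /Hx; rewrite scale1r mul1r => /Hd.
  have -> : x + y = (x - v) + (y + v) by rewrite addrACA addNr addr0.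
  have := ler_normD (x - v) (y + v); lra.
pose lo : set R := [set a | exists2 p, H p & a = p.2 - `|p.1 - v|].
have slo : has_sup lo.
  split; first by exists (0 - `|0 - v|), (0, 0).
  by exists (`|0 + v| - 0) => _ [[x t] Hx ->]; exact: gap.
exists (sup lo) => x t Hx; split.
  by apply: sup_upper_bound => //; exists (x, t).
by apply: ge_sup; [case: slo|move=> _ [[y u] Hy ->]; exact: gap].
Qed.

Lemma dominated_graph_extend H v : dominated_graph H ->
  exists H', [/\ dominated_graph H', H `<=` H' & exists t, H' (v, t)].
Proof.
move=> Hdom; have [a aP] := dominated_graph_gap v Hdom.
have [H0 Hl Hd] := Hdom.
have HZ s x t : H (x, t) -> H (s *: x, s * t).
  by move=> Hx; have := Hl s _ _ _ _ Hx H0; rewrite !addr0.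
pose H' : set (V * R) :=
  [set p | exists x t s, H (x, t) /\ p = (x + s *: v, t + s * a)].
exists H'; split; last 2 first.
- by move=> [x t] Hx; exists x, t, 0; rewrite scale0r mul0r !addr0.
- by exists a, 0, 0, 1; rewrite scale1r mul1r !add0r.
split.
- by exists 0, 0, 0; rewrite scale0r mul0r !addr0.
- move=> b _ _ _ _ [x [t [s [Hx [-> ->]]]]] [y [u [r [Hy [-> ->]]]]].
  exists (b *: x + y), (b * t + u), (b * s + r); split; first exact: Hl.
  congr (_, _); last by rewrite mulrDr mulrDl addrACA mulrA.
  by rewrite scalerDr scalerDl addrACA scalerA.
move=> _ _ [x [t [s [Hx [-> ->]]]]].
have [s0|s0|->] := ltgtP s 0; last first.
- by rewrite scale0r mul0r !addr0; exact: Hd.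
- have [_] := aP _ _ (HZ s^-1 _ _ Hx).
  have -> : x + s *: v = s *: (s^-1 *: x + v).
    by rewrite scalerDr scalerA divff ?gt_eqF// scale1r.
  rewrite normrZ gtr0_norm// -lerBrDl.
  rewrite -(ler_pM2l s0) mulrBr mulrA divff ?gt_eqF// mul1r; lra.
have r0 : 0 < - s by rewrite oppr_gt0.
have [+ _] := aP _ _ (HZ (- s)^-1 _ _ Hx).
have -> : x + s *: v = (- s) *: ((- s)^-1 *: x - v).
  by rewrite scalerBr scalerA divff ?gt_eqF// scale1r scaleNr opprK.
rewrite normrZ gtr0_norm//.
rewrite -(ler_pM2l r0) mulrBr mulrA divff ?gt_eqF// mul1r; lra.
Qed.

Theorem hahn_banach G : dominated_graph G ->
  exists2 f : dual V, forall x t, G (x, t) -> f x = t &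
    forall x, `|f x| <= `|x|.
Proof.
(* Taking the union with G lets the empty chain satisfy the condition. *)
move=> Gdom; pose P : set (set (V * R)) := [set A | dominated_graph (G `|` A)].
have [|A [Adom Amax]] := @Zorn_bigcup _ P.
  move=> F FP Ftot; have [G0 Gl Gd] := Gdom.
  have pair p q :
      (G `|` \bigcup_(A in F) A) p -> (G `|` \bigcup_(A in F) A) q ->
      G p /\ G q \/ exists A, [/\ F A, (G `|` A) p & (G `|` A) q].
    move=> [Gp|[A FA Ap]] [Gq|[B FB Bq]]; first by left.
    - by right; exists B; split; [|left|right].
    - by right; exists A; split; [|right|left].
    - by right; have [AB|BA] := Ftot _ _ FA FB;
        [exists B|exists A]; split => //; right => //; [exact: AB|exact: BA].
  split; first by left.
    move=> a x t y u xt yu; have [[]|[A [FA Ax Ay]]] := pair _ _ xt yu.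
      by move=> Gx Gy; left; exact: Gl.
    have [_ + _] := FP _ FA; move=> /(_ a _ _ _ _ Ax Ay) [GA|AA]; first by left.
    by right; exists A.
  move=> x t xt; have [[]|[A [FA Ax _]]] := pair _ _ xt xt; first by move=> /Gd.
  by have [_ _] := FP _ FA; exact.
set H := G `|` A in Adom.
have Htot x : exists t, H (x, t).
  have [H' [H'dom HH' [t H't]]] := dominated_graph_extend x Adom.
  exists t; have [//|nHt] := pselect (H (x, t)); exfalso.
  have GH' : G `|` H' = H' by apply/setUidPr => p Gp; apply: HH'; left.
  apply: (Amax H'); last by rewrite /P /= GH'.
  split; first by move=> p Ap; apply: HH'; right.
  by move=> H'A; apply: nHt; right; exact: H'A.
have [f fH] := choice Htot.
have [H0 Hl Hd] := Adom.
have Huniq x t u : H (x, t) -> H (x, u) -> t = u.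
  have le y s r : H (y, s) -> H (y, r) -> s <= r.
    move=> Hs Hr; have := Hd _ _ (Hl (-1) _ _ _ _ Hr Hs).
    by rewrite scaleN1r addNr normr0 mulN1r addrC subr_le0.
  by move=> Ht Hu; apply/eqP; rewrite eq_le (le _ _ _ Ht Hu) (le _ _ _ Hu Ht).
have flin : linear (f : V -> R^o).
  move=> a x y; apply: (Huniq (a *: x + y)); first exact: fH.
  exact: (Hl a _ (f x) _ (f y) (fH x) (fH y)).
have fle x : `|f x| <= `|x|.
  rewrite ler_norml (Hd _ _ (fH x)) andbT lerNl.
  have := Hd _ _ (Hl (-1) _ _ _ _ (fH x) H0).
  by rewrite !addr0 scaleN1r mulN1r normrN.
have fblin : (f : V -> R^o) \in bounded_linear V R^o.
  by rewrite inE; split=> // r; exists r => x; exact: le_trans.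
exists (Blin fblin : dual V) => //= x t Gx.
by apply: (Huniq x); [exact: fH|left].
Qed.

(** Extension of the functional a *: x |-> a * `|x|. *)
Lemma norming_functional (x : V) :
  exists2 f : dual V, f x = `|x| & forall y, `|f y| <= `|y|.
Proof.
pose G : set (V * R) := [set p | exists a, p = (a *: x, a * `|x|)].
have [|f fG f1] := @hahn_banach G.
  split; first by exists 0; rewrite scale0r mul0r.
    move=> a _ _ _ _ [b [-> ->]] [c [-> ->]]; exists (a * b + c).
    by rewrite scalerDl mulrDl scalerA mulrA.
  by move=> _ _ [a [-> ->]]; rewrite normrZ ler_wpM2r// ler_norm.
by exists f => //; apply: fG; exists 1; rewrite scale1r mul1r.
Qed.

(** Extension of the functional y + a *: x |-> a * d, where y ranges over E: it
    is dominated by the norm because - a^-1 *: y belongs to E, hence is at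
    distance at least d from x. *)
Lemma separating_functional (E : set V) (x : V) (d : R) : 0 < d -> E 0 ->
  (forall a y z, E y -> E z -> E (a *: y + z)) ->
  (forall y, E y -> d <= `|x - y|) ->
  exists2 f : dual V, f x != 0 & forall y, E y -> f y = 0.
Proof.
move=> d0 E0 El Ed.
pose G : set (V * R) := [set p | exists y a, E y /\ p = (y + a *: x, a * d)].
have [|f fG f1] := @hahn_banach G.
  split; first by exists 0, 0; rewrite scale0r mul0r addr0.
    move=> a _ _ _ _ [y [b [Ey [-> ->]]]] [z [c [Ez [-> ->]]]].
    exists (a *: y + z), (a * b + c); split; first exact: El.
    by rewrite scalerDr scalerDl mulrDl scalerA mulrA addrACA.
  move=> _ _ [y [a [Ey [-> ->]]]].
  have [a0|a0] := leP a 0.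
    by rewrite (le_trans _ (normr_ge0 _))// mulr_le0_ge0// ltW.
  have -> : y + a *: x = a *: (x - (- a^-1 *: y + 0)).
    rewrite addr0 scaleNr opprK scalerDr scalerA divff ?gt_eqF//.
    by rewrite scale1r addrC.
  by rewrite normrZ gtr0_norm// ler_pM2l//; apply: Ed; exact: El.
exists f => [|y Ey]; last first.
  by apply: fG; exists y, 0; rewrite scale0r addr0 mul0r.
rewrite (fG x d) ?gt_eqF//.
by exists 0, 1; rewrite add0r scale1r mul1r.
Qed.
End HahnBanach.

(** * Weak sequential compactness in separable reflexive spaces *)

Section WeakCompactness.
Context {R : realType} {X : normedModType R}.

Lemma dense_sequence : separable_space X ->
  exists e : nat -> X, forall x eps, 0 < eps -> exists k, `|x - e k| < eps.
Proof.
move=> [D [/pcard_surjP[e eD] Ddense]]; exists e => x eps eps0.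
have [|y [xy Dy]] := Ddense (ball x eps) _ (ball_open x eps).
  by exists x; exact: ballxx.
have [k _ ek] := eD _ Dy; exists k.
by rewrite ek; move: xy; rewrite -ball_normE.
Qed.

Lemma dual_le (f : dual X) x : `|f x| <= `|f| * `|x|.
Proof. exact: le_opnorm. Qed.

Lemma ultralimit_bounded (U : set_system nat) (u : nat -> R) c :
  UltraFilter U -> (forall n, `|u n| <= c) ->
  exists2 l : R, u @ U --> l & `|l| <= c.
Proof.
move=> UU uc; have [|l [/= lc clu]] := @segment_compact _ (-c) c (u @ U).
  by apply: (@filterE _ U) => n; rewrite /= in_itv /= -ler_norml.
exists l; last by move: lc; rewrite in_itv /= -ler_norml.
move=> N Nl; have [//|UN] := in_ultra_setVsetC (u @^-1` N) UU.
by have [z []] := clu (~` N) N UN Nl.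
Qed.

(** The limit along U defines a bounded functional on the dual, and reflexivity
    represents it by a vector. *)
Lemma ultralimit_weak (U : set_system nat) (x_ : nat -> X) (r : R) :
  reflexive_space X -> UltraFilter U -> (forall n, `|x_ n| <= r) ->
  exists x : X, forall f : dual X, f (x_ n) @[n --> U] --> f x.
Proof.
move=> reflX UU xr.
have lim_ (f : dual X) :
    exists l : R, f (x_ n) @[n --> U] --> l /\ `|l| <= `|f| * r.
  have [|l] := @ultralimit_bounded U (f \o x_) (`|f| * r); last by exists l.
  by move=> n; rewrite (le_trans (dual_le _ _))// ler_wpM2l.
have [phi phiP] := choice lim_.
have philin : linear (phi : dual X -> R^o).
  move=> a f g; apply: (@cvg_unique R^o _ ((fun n => (a *: f + g) (x_ n)) @ U)).
  - exact: Rhausdorff.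
  - exact: (phiP (a *: f + g)).1.
  - exact: (cvgD (cvgZl_tmp (phiP f).1) (phiP g).1).
have phib : (phi : dual X -> R^o) \in bounded_linear (dual X) R^o.
  rewrite inE; split=> // M; exists (M * r) => f fM.
  have r0 : 0 <= r by exact: le_trans (xr 0%N).
  by rewrite (le_trans (phiP f).2)// ler_wpM2r.
have [x xphi] := reflX (Blin phib).
have fx (f : dual X) : f x = phi f.
  by rewrite -[RHS]/((Blin phib : dual (dual X)) f) -xphi.
by exists x => f; rewrite fx; exact: (phiP f).1.
Qed.

(** Weak continuity is a condition on sequences, so an ultrafilter limit of x_
    is not enough.  The sequence of indices k need not be increasing: k n >= n
    already makes every eventual property of x_ eventual along k. *)
Lemma weak_compactness (x_ : nat -> X) (r : R) :
  separable_space X -> reflexive_space X -> (forall n, `|x_ n| <= r) ->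
  exists2 k : nat -> nat, forall n, (n <= k n)%N &
    exists x : X, weak_cvg (x_ \o k) x.
Proof.
move=> /dense_sequence[e eD] reflX xr.
have [U [UU oU]] := @ultraFilterLemma _ \oo _.
have [x xU] := ultralimit_weak reflX UU xr.
have /choice[g gP] : forall i, exists f : dual X,
    f (e i) = `|e i| /\ forall y, `|f y| <= `|y|.
  by move=> i; have [f ? ?] := norming_functional (e i); exists f.
(* For each n, the indices m >= n at which the first n norming functionals are
   close to their limits form an element of U, hence exist. *)
have /choice[k kP] : forall n, exists m, (n <= m)%N /\
    forall i, (i < n)%N -> `|g i x - g i (x_ m)| < n.+1%:R^-1.
  move=> n.
  have near_g i : \forall m \near U, `|g i x - g i (x_ m)| < n.+1%:R^-1.
    have /cvgrPdist_lt/(_ n.+1%:R^-1) := xU (g i).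
    by apply; rewrite invr_gt0.
  have near_all j : \forall m \near U,
      forall i, (i < j)%N -> `|g i x - g i (x_ m)| < n.+1%:R^-1.
    elim: j => [|j IH]; first exact: filterE.
    apply: filterS2 IH (near_g j) => m IH gj i.
    by rewrite ltnS leq_eqVlt => /predU1P[->|/IH].
  have near_n : U [set m | (n <= m)%N] by apply: oU; exists n.
  have [m [nm gm]] := filter_ex (filterI near_n (near_all n)).
  by exists m.
exists k => [n|]; first exact: (kP n).1.
exists x; pose E : set (dual X) :=
  [set f : dual X | f (x_ (k n)) @[n --> \oo] --> f x].
have gE i : E (g i).
  apply/cvgrPdist_lt => eps eps0.
  have [N _ NP] := near_infty_natSinv_lt (PosNum eps0).
  exists (maxn N i.+1) => // n /=; rewrite geq_max => /andP[Nn i_n].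
  exact: lt_trans ((kP n).2 _ i_n) (NP _ Nn).
have El a f h : E f -> E h -> E (a *: f + h).
  by move=> Ef Eh; exact: (cvgD (cvgZl_tmp Ef) Eh).
have E0 : E 0 by exact: cvg_cst.
move=> f; rewrite -/(E f); apply: contrapT => nEf.
(* E is closed because the sequence is bounded, so f is at a positive distance
   from it. *)
have [d d0 dE] : exists2 d, 0 < d & forall h, E h -> d <= `|f - h|.
  apply: contrapT => nd; apply: nEf; apply/cvgrPdist_lt => eps eps0.
  have r0 : 0 <= r by exact: le_trans (xr 0%N).
  pose b := r + `|x| + 1; have b0 : 0 < b by rewrite ltr_wpDl// addr_ge0.
  have d0 : 0 < eps / 2 / b by rewrite !divr_gt0.
  have [h Eh fh] : exists2 h, E h & `|f - h| < eps / 2 / b.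
    apply: contrapT => nh; apply: nd; exists (eps / 2 / b) => // h Eh.
    by rewrite leNgt; apply/negP => fh; apply: nh; exists h.
  have e20 : 0 < eps / 2 by rewrite divr_gt0.
  have /cvgrPdist_lt/(_ _ e20) := Eh; apply: filterS => n hn.
  have fhn : `|(f - h) (x - x_ (k n))| <= eps / 2.
    rewrite (le_trans (dual_le _ _))//.
    rewrite (@le_trans _ _ (`|f - h| * b))//.
      rewrite ler_wpM2l// (le_trans (ler_normB _ _))// addrC /b.
      by rewrite -addrA lerD// ler_wpDr.
    by rewrite -ler_pdivlMr// ltW.
  have -> : f x - f (x_ (k n)) =
      (f - h) (x - x_ (k n)) + (h x - h (x_ (k n))).
    by rewrite linearB /= [X in X - _ + _](_ : _ = f x - h x)//
      [X in _ - X + _](_ : _ = f (x_ (k n)) - h (x_ (k n)))//; ring.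
  by rewrite (le_lt_trans (ler_normD _ _))// [ltRHS](splitr eps) ler_ltD.
have [phi phif phiE] := separating_functional d0 E0 El dE.
have [z zphi] := reflX phi.
have phiz h : phi h = h z by rewrite -zphi.
(* If e i is close to z, then `|e i| = g i (e i - z) <= `|e i - z| is small, and
   so is `|z|. *)
have z0 : z != 0 by apply: contra_neq phif => z_0; rewrite phiz z_0 linear0.
have [i zi] : exists i, `|z - e i| < `|z| / 2.
  by apply: eD; rewrite divr_gt0 ?normr_gt0.
have giz : g i z = 0 by rewrite -phiz phiE.
have := (gP i).2 (e i - z).
rewrite linearB /= giz subr0 (gP i).1 normr_id distrC.
have := ler_normD (z - e i) (e i); rewrite subrK; lra.
Qed.
End WeakCompactness.

(** * The Galerkin method *)

Section Galerkin.
Context {R : realType} (X Y : normedModType R).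

(** A norm-convergent sequence converges weakly, and continuity on a normed
    space is sequential. *)
Lemma weakly_continuous_continuous (A : X -> dual Y) y :
  weakly_continuous A -> continuous (fun x => A x y).
Proof.
move=> Aw x; apply: contrapT => nA.
have [eps eps0 nearA] : exists2 eps : R, 0 < eps &
    forall n : nat, exists x',
      `|x - x'| < n.+1%:R^-1 /\ eps <= `|A x y - A x' y|.
  apply: contrapT => nex; apply: nA; apply/cvgrPdist_lt => eps eps0.
  apply: contrapT => nn; apply: nex; exists eps => // n.
  apply: contrapT => nx; apply: nn; apply/nbhs_ballP; exists n.+1%:R^-1 => /=.
    by rewrite invr_gt0.
  rewrite -ball_normE => x' /= xx'; rewrite ltNge; apply/negP => ex'.
  by apply: nx; exists x'.
have [u uP] := choice nearA.
have uw : weak_cvg u x.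
  move=> f; apply/cvgrPdist_lt => e e0.
  have c0 : 0 < e / (`|f| + 1) by rewrite divr_gt0// ltr_wpDl.
  have [N _ NP] := near_infty_natSinv_lt (PosNum c0).
  exists N => // n Nn /=; rewrite -linearB.
  rewrite (le_lt_trans (dual_le _ _))//.
  rewrite (@le_lt_trans _ _ ((`|f| + 1) * `|x - u n|))//.
    by rewrite ler_wpM2r// lerDl.
  rewrite -ltr_pdivlMl ?ltr_wpDl// mulrC.
  exact: lt_trans (uP n).1 (NP _ Nn).
have /cvgrPdist_lt/(_ _ eps0)[N _ /(_ N (leqnn N))] := Aw _ _ uw y.
by rewrite /= ltNge (uP N).2.
Qed.

(** Let f be a basis of a space containing e_0, ..., e_(k-1), and c the
    coordinates of x in f.  The sum over i of c_i <A x - b, Phi f_i> is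
    <A x - b, Phi x>, so the positivity on the sphere is the acute angle
    condition. *)
Lemma galerkin_solution (A : X -> dual Y) (Phi : blin X Y) (b : dual Y) (r : R)
    (e : nat -> X) (k : nat) : 0 < r -> weakly_continuous A ->
  (forall x, `|x| = r -> 0 < A x (Phi x) - b (Phi x)) ->
  exists2 x : X, `|x| <= r &
    forall i, (i < k)%N -> A x (Phi (e i)) = b (Phi (e i)).
Proof.
move=> r0 Aw Acoer; have [n [f [f0 fe]]] := lin_indep_span e k.
pose F (i : 'I_n) x : R := A x (Phi (f i)) - b (Phi (f i)).
have sumE (h : dual Y) (c : 'rV[R]_n) :
    \sum_i c ord0 i * h (Phi (f i)) = h (Phi (lin_comb f c)).
  rewrite /lin_comb !linear_sum; apply: eq_bigr => i _.
  by rewrite !linearZ.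
have [||c cr cF] := acute_angle (F := F) r0 f0.
- move=> i x; have cb : continuous_at x (fun=> b (Phi (f i)) : R).
    exact: cst_continuous.
  exact: (continuousB (@weakly_continuous_continuous A (Phi (f i)) Aw x) cb).
- move=> c cr; under eq_bigr do rewrite mulrBr.
  by rewrite sumrB !sumE; exact: Acoer.
exists (lin_comb f c) => // i /fe[c' ->].
rewrite -!sumE; apply: eq_bigr => j _; congr (_ * _).
by apply/eqP; rewrite -subr_eq0; apply/eqP; exact: cF.
Qed.
End Galerkin.

(** * Surjectivity of weakly continuous, linearly mapped coercive operators *)

Theorem theorem2p4 (R : realType) (X Y : completeNormedModType R)
    (X_separable : separable_space X) (X_reflexive : reflexive_space X)
    (Y_separable : separable_space Y) (Y_reflexive : reflexive_space Y)
    (A : X -> dual Y)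
    (A_weakly_continuous : weakly_continuous A)
    (A_coercive : linearly_mapped_coercive A) :
  forall b : dual Y, exists x : X, A x = b.
Proof.
move=> b.
have [Phi [Phi_surj Phi_coer]] := (linearly_mapped_coerciveP A).1 A_coercive.
(* With this slope, <A x, Phi x> exceeds <b, Phi x> by at least `|x|. *)
pose K := `|b| * `|Phi| + 1; have K0 : 0 < K by rewrite ltr_wpDl// mulr_ge0.
have [r r0 rP] := Phi_coer K K0.
have bPhi x : b (Phi x) <= `|b| * `|Phi| * `|x|.
  rewrite (le_trans (ler_norm _))// (le_trans (dual_le _ _))//.
  by rewrite -mulrA ler_wpM2l//; exact: le_opnorm.
have Apos x : `|x| = r -> 0 < A x (Phi x) - b (Phi x).
  move=> xr; have := rP x; rewrite xr lexx => /(_ isT); have := bPhi x.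
  by rewrite /K mulrDl mul1r xr; move: r0; lra.
have [e eD] := dense_sequence X_separable.
have /choice[x_ x_P] : forall k, exists x, `|x| <= r /\
    forall i, (i < k)%N -> A x (Phi (e i)) = b (Phi (e i)).
  move=> k; have [x xr xe] := galerkin_solution e k r0 A_weakly_continuous Apos.
  by exists x.
have [k kn [x xw]] :=
  weak_compactness X_separable X_reflexive (fun n => (x_P n).1).
exists x; have Ae i : A x (Phi (e i)) = b (Phi (e i)).
  have := A_weakly_continuous _ _ xw (Phi (e i)) => /cvg_lim <- //.
  apply: lim_near_cst => //; exists i.+1 => // n /= i_n.
  by apply: (x_P _).2; exact: leq_trans i_n (kn n).
apply/val_inj/funext => y; have [v <-] := Phi_surj y => /=.
apply/eqP; rewrite -subr_eq0 -normr_le0; apply/ler_addgt0Pr => eps eps0.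
pose c := `|A x - b| * `|Phi| + 1.
have c0 : 0 < c by rewrite ltr_wpDl// mulr_ge0.
have [i vi] := eD v (eps / c) (divr_gt0 eps0 c0).
have -> : A x (Phi v) - b (Phi v) = (A x - b) (Phi (v - e i)).
  rewrite -[RHS]/(A x (Phi (v - e i)) - b (Phi (v - e i))).
  by rewrite !linearB /= Ae; ring.
rewrite add0r (le_trans (dual_le _ _))//.
rewrite (@le_trans _ _ (c * `|v - e i|))//; last first.
  by rewrite mulrC -ler_pdivlMr// ltW.
rewrite (@le_trans _ _ (`|A x - b| * (`|Phi| * `|v - e i|)))//.
  by rewrite ler_wpM2l//; exact: le_opnorm.
by rewrite mulrA ler_wpM2r// lerDl.
Qed.
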